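(* Let $s:\mathbb{C}\to\mathbb{P}^1$ be a meromorphic function, $s\not\equiv\infty$. Write $s=q/q_1$ with $q,q_1$ entire functions without common zeros, and let $g_1$ be an entire function such that, with $g=q_1/e^{g_1}$, the functions $1/g$ and $s$ have the same principal parts, so that $h=s-1/g$ is an entire function. Let $\varphi^{-g_1}$ be the complex flow of the complete vector field $Z^{-g_1}=e^{-g_1(z)}[q_1(z)w-q(z)]\,\partial/\partial w$ and let $f^{-g_1}(z,t)=\varphi^{-g_1}(t,z,h(z))$. Then $f^{-g_1}$ is the Buzzard–Lu dominating map $\Phi:\mathbb{C}^2\to\mathbb{C}^2\setminus\mathrm{graph}(s)$, i.e. $f^{-g_1}(z,t)=\Phi(z,t)$ for all $(z,t)\in\mathbb{C}^2$, where $$\Phi(z,t)=\bigl(z,\ h(z)-\Psi(g(z),t)\bigr)=\left(z,\ s(z)-\frac{e^{g(z)t}}{g(z)}\right),\qquad \Psi(x,y)=\frac{e^{xy}-1}{x}.$$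
   Context: Coordinates are $(z,w)$. The flow $\varphi^{-g_1}(t,z,w)$ is the value at complex time $t$ of the solution of $Z^{-g_1}$ starting at $(z,w)$ at time $0$. The function $\Psi(x,y)=y+\frac{xy^2}{2!}+\frac{x^2y^3}{3!}+\cdots$ is entire on $\mathbb{C}^2$, with $\Psi(0,y)=y$; hence the second component of $\Phi$ is entire and equals $h(z)-t$ when $g(z)=0$. $\mathrm{graph}(s)\subset\mathbb{C}^2$ is $\{(z,s(z)): s(z)\ne\infty\}$. *)

(* Defs.v *)
From Stdlib Require Import Factorial Reals.
From Coquelicot Require Export Coquelicot.
Local Open Scope C_scope.

Definition C2 : NormedModule C_AbsRing :=
  prod_NormedModule C_AbsRing C_NormedModule C_NormedModule.

Definition Cexp (z : C) : C :=
  ((exp (Re z) * cos (Im z))%R, (exp (Re z) * sin (Im z))%R).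

Definition holomorphic_at (u : C -> C) (z : C) : Prop :=
  ex_derive (K := C_AbsRing) (V := C_NormedModule) u z.

Definition entire (u : C -> C) : Prop := forall z : C, holomorphic_at u z.

(** The Riemann sphere. *)
Inductive P1 : Type :=
  | Fin : C -> P1
  | Inf : P1.

(** [a / b] in the sphere, meaningful unless [a = b = 0]. *)
Definition quot_P1 (a b : C) : P1 :=
  if Ceq_dec b 0 then Inf else Fin (a / b).

Definition inv_P1 (x : P1) : P1 :=
  match x with
  | Fin a => quot_P1 1 a
  | Inf => Fin 0
  end.

Definition holomorphic_near_P1 (f : C -> P1) (p : C) : Prop :=
  exists u : C -> C,
    locally (T := C_UniformSpace) p
      (fun z => holomorphic_at u z /\ f z = Fin (u z)).

(** Holomorphic maps to the sphere, read in the two charts [x] and [1/x];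
    the constant [Inf] is included. *)
Definition meromorphic (f : C -> P1) : Prop :=
  forall p : C,
    holomorphic_near_P1 f p \/ holomorphic_near_P1 (fun z => inv_P1 (f z)) p.

(** [sum_(k <= N) a_k / (z - p)^(k+1)] is the principal part of [f] at [p]:
    the difference continues holomorphically to [p].  Some [a_k] may vanish,
    so that [a = 0] is the principal part at a regular point. *)
Definition is_principal_part (f : C -> P1) (p : C) (a : nat -> C) (N : nat)
  : Prop :=
  exists u : C -> C,
    locally (T := C_UniformSpace) p (holomorphic_at u) /\
    locally' (T := C_UniformSpace) p
      (fun z => f z =
         Fin (u z + sum_n (G := C_AbelianMonoid)
                      (fun k => a k / (z - p) ^ (S k)) N)).

Definition same_principal_parts (f1 f2 : C -> P1) : Prop :=
  forall p : C, exists (a : nat -> C) (N : nat),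
    is_principal_part f1 p a N /\ is_principal_part f2 p a N.

Definition g_fun (q1 g1 : C -> C) (z : C) : C := q1 z / Cexp (g1 z).

(** [h] is the entire function [s - 1/g]; the values of [h] at the poles are
    determined by continuity. *)
Definition is_entire_difference (s : C -> P1) (g h : C -> C) : Prop :=
  entire h /\ forall (z a : C), s z = Fin a -> h z = a - 1 / g z.

Definition integral_curve (Z : C2 -> C2) (x : C2) (gamma : C -> C2) : Prop :=
  gamma 0 = x /\
  forall t : C,
    is_derive (K := C_AbsRing) (V := C2) gamma t (Z (gamma t)).

Definition complete_vector_field (Z : C2 -> C2) : Prop :=
  forall x : C2, exists gamma : C -> C2, integral_curve Z x gamma.

Definition is_complex_flow (Z : C2 -> C2) (phi : C -> C2 -> C2) : Prop :=
  forall x : C2, integral_curve Z x (fun t => phi t x).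

(** [e^(-g1(z)) (q1(z) w - q(z)) d/dw]. *)
Definition Z_field (q q1 g1 : C -> C) (p : C2) : C2 :=
  (RtoC 0, Cexp (- g1 (fst p)) * (q1 (fst p) * snd p - q (fst p))).

(** [Psi x y = y + x y^2/2! + x^2 y^3/3! + ...]; [iota] returns the unique sum
    of the series. *)
Definition Psi (x y : C) : C :=
  iota (T := C_CompleteNormedModule)
    (fun l : C =>
       is_series (K := C_AbsRing) (V := C_NormedModule)
         (fun n => x ^ n * y ^ (S n) / INR (fact (S n))) l).

Definition Phi (g h : C -> C) (p : C2) : C2 :=
  (fst p, h (fst p) - Psi (g (fst p)) (snd p)).

Definition graph (s : C -> P1) (p : C2) : Prop := s (fst p) = Fin (snd p).

Definition jacobian_det (l : C2 -> C2) : C :=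
  fst (l (RtoC 1, RtoC 0)) * snd (l (RtoC 0, RtoC 1))
  - fst (l (RtoC 0, RtoC 1)) * snd (l (RtoC 1, RtoC 0)).

(** A holomorphic map from [C^2] to the open set [X] of [C^2] whose Jacobian
    determinant does not vanish identically. *)
Definition dominating_map (F : C2 -> C2) (X : C2 -> Prop) : Prop :=
  (forall p : C2, X (F p)) /\
  (forall p : C2, ex_filterdiff F (locally p)) /\
  (exists (p : C2) (l : C2 -> C2),
     filterdiff F (locally p) l /\ jacobian_det l <> 0).

(* Main.v *)
(** On the line [z = const] the field is [g(z) w - q(z) e^(-g1(z))], affine in [w],
    so its flow is [w + (g(z) w - q(z) e^(-g1(z))) Psi(g(z), t)].  Clearing
    denominators in [h = s - 1/g] gives [q1 h = q - e^g1], also at the poles by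
    continuity; hence the coefficient of [Psi] is [-1] at [w = h(z)], which is
    [Phi].  Everything about [Psi x y = y Psi1(x y)], where
    [Psi1 u = (e^u - 1) / u], follows from a Taylor estimate for the complex
    exponential. *)
Require Import Defs.
From Stdlib Require Import Factorial Reals Lra Lia.
From Coquelicot Require Import Coquelicot.
Local Open Scope C_scope.

(** * The complex exponential and its Taylor estimate *)

Lemma Cexp_0 : Cexp 0 = 1.
Proof.
unfold Cexp; simpl; rewrite exp_0, cos_0, sin_0.
apply injective_projections; simpl; ring.
Qed.

Lemma Cexp_plus (x y : C) : Cexp (x + y) = Cexp x * Cexp y.
Proof.
destruct x as [a b], y as [c d]; unfold Cexp; simpl.
rewrite exp_plus, cos_plus, sin_plus.
apply injective_projections; simpl; ring.
Qed.

Lemma Cexp_neq_0 (z : C) : Cexp z <> 0.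
Proof.
intros H; apply C1_nz.
rewrite <- Cexp_0; replace (RtoC 0) with (z + - z) by ring.
rewrite Cexp_plus, H; ring.
Qed.

Lemma Cexp_opp (z : C) : Cexp (- z) = / Cexp z.
Proof.
assert (H : Cexp z * Cexp (- z) = 1).
{ rewrite <- Cexp_plus, Cplus_opp_r; apply Cexp_0. }
rewrite <- (Cmult_1_l (/ Cexp z)), <- H; field; apply Cexp_neq_0.
Qed.

Lemma Cmod_Cexp (z : C) : Cmod (Cexp z) = exp (Re z).
Proof.
unfold Cmod, Cexp; simpl.
replace (_ + _)%R with (exp (Re z) * exp (Re z))%R.
- apply sqrt_square, Rlt_le, exp_pos.
- pose proof (sin2_cos2 (Im z)) as H; unfold Rsqr in H.
  transitivity (exp (Re z) * exp (Re z)
    * (sin (Im z) * sin (Im z) + cos (Im z) * cos (Im z)))%R.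
  + rewrite H; ring.
  + ring.
Qed.

Lemma Re_sum_n (a : nat -> C) (N : nat) :
  Re (sum_n (G := C_AbelianMonoid) a N) = sum_f_R0 (fun n => Re (a n)) N.
Proof.
induction N as [|N IH].
- now rewrite sum_O.
- rewrite sum_Sn; simpl sum_f_R0; rewrite <- IH; reflexivity.
Qed.

Lemma Re_Rmult (r : R) (z : C) : Re (r * z) = (r * Re z)%R.
Proof. unfold Re; simpl; ring. Qed.

(** Along a ray, the real part gives a real function of a real variable, to which the real Taylor
    theorem applies. The factor [a] absorbs the powers of [u] produced by differentiation and
    selects the direction in which the remainder is measured. *)
Definition exp_ray (a u : C) (t : R) : R := Re (a * Cexp (t * u)).

Lemma is_derive_exp_ray (a u : C) (t : R) :
  is_derive (exp_ray a u) t (exp_ray (a * u) u t).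
Proof.
destruct a as [a1 a2], u as [u1 u2]; unfold exp_ray, Cexp; simpl.
auto_derive; [easy | ].
replace (t * u1 + - (0 * u2))%R with (t * u1 - 0 * u2)%R by ring; ring.
Qed.

Lemma is_derive_n_exp_ray (a u : C) (n : nat) (t : R) :
  is_derive_n (exp_ray a u) n t (exp_ray (a * u ^ n) u t).
Proof.
revert t; induction n as [|n IH]; intros t.
- simpl; now rewrite Cmult_1_r.
- simpl; apply is_derive_ext with (exp_ray (a * u ^ n) u).
  + intros s; symmetry; apply is_derive_n_unique, IH.
  + replace (a * (u * u ^ n)) with (a * u ^ n * u) by ring.
    apply is_derive_exp_ray.
Qed.

Definition Cexp_sum (u : C) (N : nat) : C :=
  sum_n (G := C_AbelianMonoid) (fun k => u ^ k / INR (fact k)) N.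

(* Lagrange's remainder for the real function [t |-> Re (a e^(t u))] on [[0, 1]]. *)
Lemma Re_Cexp_taylor (a u : C) (N : nat) :
  (Rabs (Re (a * (Cexp u - Cexp_sum u N)))
   <= Cmod a * (exp (Cmod u) * (Cmod u ^ S N / INR (fact (S N)))))%R.
Proof.
destruct (Taylor_Lagrange (exp_ray a u) N 0 1 Rlt_0_1) as [c [Hc E]].
{ intros t _ k _; destruct k; [easy | ].
  eexists; exact (is_derive_n_exp_ray a u (S k) t). }
rewrite (is_derive_n_unique _ _ _ _ (is_derive_n_exp_ray a u (S N) c)) in E.
replace (Re _) with (1 / INR (fact (S N)) * exp_ray (a * u ^ S N) u c)%R.
- unfold exp_ray; rewrite Rabs_mult.
  assert (F : (0 < INR (fact (S N)))%R) by apply INR_fact_lt_0.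
  rewrite Rabs_pos_eq by (apply Rdiv_le_0_compat; lra).
  (* Since [c] lies between [0] and [1], the modulus of [Cexp (c * u)], which is the exponential of
     [Re (c * u)], is at most [exp (Cmod u)]. *)
  assert (B : (Rabs (Re (a * u ^ S N * Cexp (c * u))) <=
     Cmod a * Cmod u ^ S N * exp (Cmod u))%R).
  { eapply Rle_trans; [apply re_le_Cmod | ].
    rewrite !Cmod_mult, Cmod_pow, Cmod_Cexp.
    apply Rmult_le_compat_l.
    { apply Rmult_le_pos; [ | apply pow_le]; apply Cmod_ge_0. }
    assert (L : (Re (c * u) <= Cmod u)%R).
    { eapply Rle_trans; [apply Rle_abs | ].
      eapply Rle_trans; [apply re_le_Cmod | ].
      rewrite Cmod_mult, Cmod_R, Rabs_pos_eq by lra.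
      pose proof (Cmod_ge_0 u); nra. }
    destruct L as [L | L]; [ | rewrite L; lra].
    now apply Rlt_le, exp_increasing. }
  apply Rmult_le_compat_l with (r := (1 / INR (fact (S N)))%R) in B.
  + eapply Rle_trans; [exact B | right; field; lra].
  + apply Rdiv_le_0_compat; lra.
- rewrite Rminus_0_r, pow1 in E.
  assert (E1 : exp_ray a u 1 = Re (a * Cexp u)).
  { unfold exp_ray; now rewrite Cmult_1_l. }
  rewrite E1 in E.
  replace (a * (Cexp u - Cexp_sum u N))
    with (a * Cexp u + - (a * Cexp_sum u N)) by ring.
  (* The derivative of order [m] at [0] is [Re (a * u ^ m)], so the real Taylor polynomial at
     [t = 1] is the real part of [a] times the partial sum. *)
  assert (D : Re (a * Cexp_sum u N) = (sum_f_R0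
      (fun m : nat => 1 ^ m / INR (fact m) * Derive_n (exp_ray a u) m 0) N)%R).
  { transitivity (Re (sum_n (G := C_AbelianMonoid)
      (fun k => a * (u ^ k / INR (fact k))) N)).
    { f_equal; symmetry; apply (sum_n_mult_l (K := C_Ring)). }
    rewrite Re_sum_n; apply sum_eq; intros m _.
    rewrite (is_derive_n_unique _ _ _ _ (is_derive_n_exp_ray a u m 0)).
    unfold exp_ray; rewrite Cmult_0_l, Cexp_0, Cmult_1_r, pow1.
    pose proof (INR_fact_neq_0 m).
    rewrite <- Re_Rmult; f_equal; rewrite RtoC_div by easy; field.
    intros F; apply H; now injection F. }
  rewrite re_plus, re_opp, E, <- D; ring.
Qed.

(** Take for [a] the conjugate of the remainder [r]: the real part of [a * r] is then the square of
    [Cmod r], and one factor [Cmod r] cancels unless it is zero. *)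
Lemma Cexp_taylor (u : C) (N : nat) :
  (Cmod (Cexp u - Cexp_sum u N)
   <= exp (Cmod u) * (Cmod u ^ S N / INR (fact (S N))))%R.
Proof.
pose proof (fun a => Re_Cexp_taylor a u N) as H.
set (r := Cexp u - _) in *; set (B := (exp _ * _)%R) in *.
specialize (H (Cconj r)).
replace (Rabs _) with (Cmod r * Cmod r)%R in H.
- rewrite Cmod_conj in H.
  destruct (Cmod_ge_0 r) as [P | P].
  + now apply Rmult_le_reg_l with (Cmod r).
  + rewrite <- P; unfold B; apply Rmult_le_pos; [apply Rlt_le, exp_pos | ].
    apply Rdiv_le_0_compat; [apply pow_le, Cmod_ge_0 | apply INR_fact_lt_0].
- replace (Cmod r * Cmod r)%R with (Cmod r ^ 2)%R by ring; rewrite Cmod2_alt.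
  clearbody r; destruct r as [x y]; simpl; rewrite Rabs_pos_eq by nra; ring.
Qed.

(** * The function (e^u - 1) / u, its power series, and [Psi] *)

Definition Psi1 (u : C) : C :=
  if Ceq_dec u 0 then 1 else (Cexp u - 1) / u.

Definition Psi1_sum (u : C) (N : nat) : C :=
  sum_n (G := C_AbelianMonoid) (fun k => u ^ k / INR (fact (S k))) N.

Lemma RtoC_INR_fact_neq_0 (n : nat) : RtoC (INR (fact n)) <> 0.
Proof. intros H; apply (INR_fact_neq_0 n); now injection H. Qed.

Lemma Psi1_0 : Psi1 0 = 1.
Proof. unfold Psi1; now destruct (Ceq_dec 0 0). Qed.

Lemma Psi1_neq_0 (u : C) : u <> 0 -> Psi1 u = (Cexp u - 1) / u.
Proof. intros H; unfold Psi1; now destruct (Ceq_dec u 0). Qed.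

Lemma Cexp_Psi1 (u : C) : Cexp u = 1 + u * Psi1 u.
Proof.
destruct (Ceq_dec u 0) as [-> | H].
- rewrite Cexp_0; ring.
- rewrite Psi1_neq_0 by easy; field; easy.
Qed.

Lemma Cexp_sum_Psi1_sum (u : C) (N : nat) :
  Cexp_sum u (S N) = 1 + u * Psi1_sum u N.
Proof.
induction N as [|N IH]; unfold Cexp_sum, Psi1_sum in *.
- rewrite sum_Sn, !sum_O.
  change (u ^ 0 / INR (fact 0) + u ^ 1 / INR (fact 1)
    = 1 + u * (u ^ 0 / INR (fact 1))).
  simpl; field.
- rewrite sum_Sn, IH, (sum_Sn _ N).
  set (T := sum_n _ N).
  change (1 + u * T + u ^ S (S N) / INR (fact (S (S N))) =
    1 + u * (T + u ^ S N / INR (fact (S (S N))))).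
  rewrite (Cpow_S u (S N)); field; apply RtoC_INR_fact_neq_0.
Qed.

Lemma Psi1_sum_0 (N : nat) : Psi1_sum 0 N = 1.
Proof.
induction N as [|N IH]; unfold Psi1_sum in *.
- rewrite sum_O; simpl; field.
- rewrite sum_Sn, IH.
  change (1 + 0 ^ S N / INR (fact (S (S N))) = 1).
  rewrite Cpow_S; field; apply RtoC_INR_fact_neq_0.
Qed.

(** For nonzero [u] this is the estimate for [Cexp] at order [S N] divided by [Cmod u]; at [0] the
    remainder vanishes. *)
Lemma Psi1_taylor (u : C) (N : nat) :
  (Cmod (Psi1 u - Psi1_sum u N)
   <= exp (Cmod u) * (Cmod u ^ S N / INR (fact (S (S N)))))%R.
Proof.
destruct (Ceq_dec u 0) as [-> | H].
- rewrite Psi1_0, Psi1_sum_0; replace (1 - 1) with (RtoC 0) by ring.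
  rewrite Cmod_0; simpl pow; rewrite Rmult_0_l; unfold Rdiv; rewrite Rmult_0_l; lra.
- pose proof (Cexp_taylor u (S N)) as B.
  rewrite Cexp_Psi1, Cexp_sum_Psi1_sum in B.
  replace (1 + u * Psi1 u - (1 + u * Psi1_sum u N))
    with (u * (Psi1 u - Psi1_sum u N)) in B by ring.
  rewrite Cmod_mult in B; apply Cmod_gt_0 in H.
  apply Rmult_le_reg_l with (1 := H).
  eapply Rle_trans; [exact B | right; rewrite <- (tech_pow_Rmult _ (S N)); field].
  apply INR_fact_neq_0.
Qed.

Lemma is_series_Psi1 (u : C) :
  is_series (K := C_AbsRing) (V := C_NormedModule)
    (fun n => u ^ n / INR (fact (S n))) (Psi1 u).
Proof.
apply (filterlim_locally_ball_norm (K := C_AbsRing) (U := C_NormedModule)).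
intros eps; set (M := exp (Cmod u)).
assert (HM : (0 < M)%R) by apply exp_pos.
(* The ratio of powers to factorials tends to [0]. It is used at index [S n], and the remainder has
   the still larger factorial of [S (S n)] in its denominator; dividing [eps] by [M] makes up for
   the exponential factor. *)
destruct (cv_speed_pow_fact (Cmod u) (eps / M)%R) as [N HN].
{ apply Rdiv_lt_0_compat; [apply cond_pos | easy]. }
exists N; intros n Hn.
change (Cmod (Psi1_sum u n - Psi1 u) < eps)%R.
replace (Psi1_sum u n - Psi1 u) with (- (Psi1 u - Psi1_sum u n)) by ring.
rewrite Cmod_opp.
eapply Rle_lt_trans; [apply Psi1_taylor | fold M].
specialize (HN (S n) ltac:(lia)); unfold Rdist in HN.
rewrite Rminus_0_r in HN; apply Rle_lt_trans with (1 := Rle_abs _) in HN.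
apply Rmult_lt_compat_l with (1 := HM) in HN.
replace (M * (eps / M))%R with (pos eps) in HN by (field; lra).
eapply Rle_lt_trans; [ | exact HN].
apply Rmult_le_compat_l; [lra | ].
apply Rmult_le_compat_l; [apply pow_le, Cmod_ge_0 | ].
apply Rinv_le_contravar; [apply INR_fact_lt_0 | apply le_INR, fact_le; lia].
Qed.

(** Taking [y] out of each term leaves the series of [Psi1] at [x * y]; since limits are unique,
    [iota] can return no other sum. *)
Lemma Psi_eq (x y : C) : Psi x y = y * Psi1 (x * y).
Proof.
assert (H : is_series (K := C_AbsRing) (V := C_NormedModule)
  (fun n => x ^ n * y ^ S n / INR (fact (S n))) (y * Psi1 (x * y))).
{ apply is_series_ext with (fun n => y * ((x * y) ^ n / INR (fact (S n)))).
  - intros n; rewrite Cpow_mult_l, (Cpow_S y n).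
    change (y * (x ^ n * y ^ n / INR (fact (S n)))
      = x ^ n * (y * y ^ n) / INR (fact (S n))).
    field; apply RtoC_INR_fact_neq_0.
  - exact (is_series_scal (K := C_AbsRing) (V := C_NormedModule) y _ _
      (is_series_Psi1 (x * y))). }
apply (iota_unique (V := C_CompleteNormedModule)); [ | exact H].
intros l Hl.
exact (filterlim_locally_unique (V := C_NormedModule) _ _ _ Hl H).
Qed.

Lemma Psi_closed (x y : C) : x <> 0 -> Psi x y = (Cexp (x * y) - 1) / x.
Proof. intros H; rewrite Psi_eq, Cexp_Psi1; field; easy. Qed.

Lemma Psi_0_l (y : C) : Psi 0 y = y.
Proof. rewrite Psi_eq, Cmult_0_l, Psi1_0; ring. Qed.

Lemma Cexp_Psi (x y : C) : Cexp (x * y) = 1 + x * Psi x y.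
Proof. rewrite Psi_eq, Cexp_Psi1; ring. Qed.

(** * Calculus of complex derivatives in one variable *)

Notation C_self := (AbsRing_NormedModule C_AbsRing).
Definition is_C_derive (f : C -> C) (z l : C) : Prop :=
  is_derive (K := C_AbsRing) (V := C_NormedModule) f z l.

(* [C_self] and [C_NormedModule] have convertible norms but different uniform
   structures, and [filterdiff] only looks at the norm of the codomain. *)
Lemma filterdiff_C_self (U : NormedModule C_AbsRing) (f : U -> C)
  (F : (U -> Prop) -> Prop) (l : U -> C) :
  filterdiff (V := C_self) f F l <-> filterdiff (V := C_NormedModule) f F l.
Proof.
split; intros [[Hp Hs Hn] Hd]; (split; [split; assumption | exact Hd]).
Qed.

Lemma is_C_derive_ext (f g : C -> C) (z l : C) :
  (forall x, f x = g x) -> is_C_derive f z l -> is_C_derive g z l.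
Proof. exact (is_derive_ext (V := C_NormedModule) f g z l). Qed.

Lemma is_C_derive_plus (f g : C -> C) (z a b : C) :
  is_C_derive f z a -> is_C_derive g z b ->
  is_C_derive (fun x => f x + g x) z (a + b).
Proof. exact (is_derive_plus (V := C_NormedModule) f g z a b). Qed.

Lemma is_C_derive_minus (f g : C -> C) (z a b : C) :
  is_C_derive f z a -> is_C_derive g z b ->
  is_C_derive (fun x => f x - g x) z (a - b).
Proof. exact (is_derive_minus (V := C_NormedModule) f g z a b). Qed.

Lemma is_C_derive_mult (f g : C -> C) (z a b : C) :
  is_C_derive f z a -> is_C_derive g z b ->
  is_C_derive (fun x => f x * g x) z (a * g z + f z * b).
Proof.
intros Hf Hg; apply filterdiff_C_self in Hf, Hg; apply filterdiff_C_self.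
exact (is_derive_mult f g z a b Hf Hg Cmult_comm).
Qed.

Lemma is_C_derive_comp (f g : C -> C) (z a b : C) :
  is_C_derive f (g z) a -> is_C_derive g z b ->
  is_C_derive (fun x => f (g x)) z (b * a).
Proof.
intros Hf Hg; apply filterdiff_C_self in Hg.
exact (is_derive_comp f g z a b Hf Hg).
Qed.

Lemma is_C_derive_const (a z : C) : is_C_derive (fun _ => a) z 0.
Proof. exact (is_derive_const (V := C_NormedModule) a z). Qed.

Lemma is_C_derive_id (z : C) : is_C_derive (fun x => x) z 1.
Proof. apply filterdiff_C_self; exact (is_derive_id z). Qed.

(** An error of second order is [o(y - z)]. This is the common entry point for the derivatives of
    [Cexp], of [Cinv] and of [Psi1] at [0], where explicit estimates are at hand. *)
Lemma is_C_derive_of_quadratic_bound (f : C -> C) (z l : C) (M : R) (d : posreal) :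
  (forall y, (Cmod (y - z) < d)%R ->
     (Cmod (f y - f z - (y - z) * l) <= M * Cmod (y - z) ^ 2)%R) ->
  is_C_derive f z l.
Proof.
intros H; split; [apply is_linear_scal_l | ].
intros z' Hz'; apply (is_filter_lim_locally_unique (V := C_self)) in Hz'; subst z'.
intros eps.
(* The sign of [M] is unknown, so a strictly positive majorant replaces it as a divisor. *)
assert (HM : (0 < Rabs M + 1)%R) by (pose proof (Rabs_pos M); lra).
assert (He : (0 < eps / (Rabs M + 1))%R)
  by (apply Rdiv_lt_0_compat; [apply cond_pos | easy]).
exists (mkposreal _ (Rmin_stable_in_posreal d (mkposreal _ He))).
intros y Hy; change (Cmod (y - z) < Rmin d (eps / (Rabs M + 1)))%R in Hy.
change (Cmod (f y - f z - (y - z) * l) <= eps * Cmod (y - z))%R.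
assert (Hd : (Cmod (y - z) < d)%R)
  by (eapply Rlt_le_trans; [exact Hy | apply Rmin_l]).
assert (He' : (Cmod (y - z) < eps / (Rabs M + 1))%R)
  by (eapply Rlt_le_trans; [exact Hy | apply Rmin_r]).
eapply Rle_trans; [apply (H y Hd) | ].
replace (M * Cmod (y - z) ^ 2)%R with (M * Cmod (y - z) * Cmod (y - z))%R by ring.
apply Rmult_le_compat_r; [apply Cmod_ge_0 | ].
apply Rle_trans with ((Rabs M + 1) * (eps / (Rabs M + 1)))%R.
- pose proof (Rle_abs M); pose proof (Cmod_ge_0 (y - z)).
  apply Rle_trans with ((Rabs M + 1) * Cmod (y - z))%R; [nra | ].
  apply Rmult_le_compat_l; lra.
- right; field; lra.
Qed.

(** By the addition formula the error is e^z times the Taylor remainder of order 1 at [y - z]. On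
    the unit disc that remainder is at most [exp 1] times the square of [Cmod (y - z)]. *)
Lemma is_C_derive_Cexp (z : C) : is_C_derive Cexp z (Cexp z).
Proof.
apply is_C_derive_of_quadratic_bound
  with (Cmod (Cexp z) * exp 1)%R (mkposreal 1 Rlt_0_1).
simpl pos; intros y Hy.
replace (Cexp y - Cexp z - (y - z) * Cexp z)
  with (Cexp z * (Cexp (y - z) - Cexp_sum (y - z) 1)).
- rewrite Cmod_mult, Rmult_assoc.
  apply Rmult_le_compat_l; [apply Cmod_ge_0 | ].
  eapply Rle_trans; [apply Cexp_taylor | ].
  apply Rmult_le_compat.
  + apply Rlt_le, exp_pos.
  + apply Rdiv_le_0_compat; [apply pow_le, Cmod_ge_0 | apply INR_fact_lt_0].
  + now apply Rlt_le, exp_increasing.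
  + simpl; pose proof (Cmod_ge_0 (y - z)); nra.
- rewrite Cexp_sum_Psi1_sum; unfold Psi1_sum; rewrite sum_O.
  assert (E : Cexp y = Cexp z * Cexp (y - z))
    by (rewrite <- Cexp_plus; f_equal; ring).
  rewrite E; simpl; field.
Qed.

(** The error is exactly [(y - z) ^ 2 / (y * z ^ 2)]. On the disc of radius [Cmod z / 2] the modulus
    of [y] exceeds [Cmod z / 2], whence the constant [2 / Cmod z ^ 3]. *)
Lemma is_C_derive_Cinv (z : C) : z <> 0 -> is_C_derive Cinv z (- / (z * z)).
Proof.
intros Hz; assert (Hm := proj1 (Cmod_gt_0 z) Hz).
assert (Hd : (0 < Cmod z / 2)%R) by lra.
apply is_C_derive_of_quadratic_bound with (2 / Cmod z ^ 3)%R (mkposreal _ Hd).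
simpl pos; intros y Hy.
assert (Hy' : (Cmod z / 2 < Cmod y)%R).
{ pose proof (Cmod_triangle (- (y - z)) y) as T.
  replace (- (y - z) + y) with z in T by ring; rewrite Cmod_opp in T; lra. }
assert (Hy0 : y <> 0) by (apply Cmod_gt_0; lra).
replace (/ y - / z - (y - z) * - / (z * z))
  with ((y - z) ^ 2 * / (y * z ^ 2)) by (simpl; field; easy).
rewrite Cmod_mult, Cmod_pow, Rmult_comm.
apply Rmult_le_compat_r; [apply pow_le, Cmod_ge_0 | ].
rewrite Cmod_inv, Cmod_mult, Cmod_pow
  by (apply Cmult_neq_0; [ | apply Cpow_nz]; easy).
apply Rle_trans with (/ (Cmod z / 2 * Cmod z ^ 2))%R.
- apply Rinv_le_contravar.
  + apply Rmult_lt_0_compat; [lra | now apply pow_lt].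
  + apply Rmult_le_compat_r; [apply pow_le | ]; lra.
- right; field; lra.
Qed.

Lemma holomorphic_at_const (a z : C) : holomorphic_at (fun _ => a) z.
Proof. eexists; apply is_C_derive_const. Qed.

Lemma holomorphic_at_id (z : C) : holomorphic_at (fun x => x) z.
Proof. eexists; apply is_C_derive_id. Qed.

Lemma holomorphic_at_minus (f g : C -> C) (z : C) :
  holomorphic_at f z -> holomorphic_at g z -> holomorphic_at (fun x => f x - g x) z.
Proof.
intros [a Ha] [b Hb]; eexists.
now apply is_C_derive_minus; [apply Ha | apply Hb].
Qed.

Lemma holomorphic_at_mult (f g : C -> C) (z : C) :
  holomorphic_at f z -> holomorphic_at g z -> holomorphic_at (fun x => f x * g x) z.
Proof.
intros [a Ha] [b Hb]; eexists.
now apply is_C_derive_mult; [apply Ha | apply Hb].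
Qed.

Lemma holomorphic_at_comp (f g : C -> C) (z : C) :
  holomorphic_at f (g z) -> holomorphic_at g z ->
  holomorphic_at (fun x => f (g x)) z.
Proof.
intros [a Ha] [b Hb]; eexists.
now apply is_C_derive_comp; [apply Ha | apply Hb].
Qed.

Lemma holomorphic_at_div (f g : C -> C) (z : C) :
  holomorphic_at f z -> holomorphic_at g z -> g z <> 0 ->
  holomorphic_at (fun x => f x / g x) z.
Proof.
intros Hf Hg H; apply holomorphic_at_mult; [easy | ].
apply (holomorphic_at_comp Cinv g); [ | easy].
eexists; now apply is_C_derive_Cinv.
Qed.

Lemma entire_Cexp : entire Cexp.
Proof. intros z; eexists; apply is_C_derive_Cexp. Qed.

Lemma holomorphic_at_ext_loc (f g : C -> C) (z : C) :
  locally (T := C_UniformSpace) z (fun x => f x = g x) ->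
  holomorphic_at f z -> holomorphic_at g z.
Proof.
intros H [a Ha]; exists a.
(* The product uniform structure and the one given by the modulus have the same neighbourhoods. *)
apply locally_C in H.
now apply (is_derive_ext_loc (V := C_NormedModule) f g z a).
Qed.

Lemma holomorphic_at_continuous (f : C -> C) (z : C) : holomorphic_at f z ->
  filterlim f (locally (T := C_UniformSpace) z)
    (locally (T := C_UniformSpace) (f z)).
Proof.
intros H; apply (ex_derive_continuous (V := C_NormedModule)) in H.
intros P HP; apply H in HP; now apply locally_C.
Qed.

Lemma holomorphic_at_neq_0 (f : C -> C) (z : C) : holomorphic_at f z -> f z <> 0 ->
  locally (T := C_UniformSpace) z (fun x => f x <> 0).
Proof.
intros H H0; apply holomorphic_at_continuous in H.
apply (H (fun y => y <> 0)); apply locally_C.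
exists (mkposreal _ (proj1 (Cmod_gt_0 _) H0)); intros y Hy E; subst y.
change (Cmod (0 - f z) < Cmod (f z))%R in Hy.
replace (0 - f z) with (- f z) in Hy by ring; rewrite Cmod_opp in Hy; lra.
Qed.

(** Away from [0] this is a quotient of holomorphic functions. At [0] the partial sum 1 + u/2 gives
    the derivative, with a quadratic error from the Taylor estimate. *)
Lemma entire_Psi1 : entire Psi1.
Proof.
intros z; destruct (Ceq_dec z 0) as [-> | Hz].
- exists (/ 2).
  apply is_C_derive_of_quadratic_bound with (exp 1) (mkposreal 1 Rlt_0_1).
  simpl pos; intros y Hy; replace (y - 0) with y in * by ring.
  replace (Psi1 y - Psi1 0 - y * / 2) with (Psi1 y - Psi1_sum y 1).
  + eapply Rle_trans; [apply Psi1_taylor | ].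
    apply Rmult_le_compat.
    * apply Rlt_le, exp_pos.
    * apply Rdiv_le_0_compat; [apply pow_le, Cmod_ge_0 | apply INR_fact_lt_0].
    * now apply Rlt_le, exp_increasing.
    * simpl; pose proof (Cmod_ge_0 y); nra.
  + rewrite Psi1_0; unfold Psi1_sum; rewrite sum_Sn, sum_O.
    change (Psi1 y - (y ^ 0 / INR (fact 1) + y ^ 1 / INR (fact 2))
      = Psi1 y - 1 - y * / 2).
    simpl; rewrite !RtoC_plus; field.
- apply holomorphic_at_ext_loc with (fun x => (Cexp x - 1) / x).
  + generalize (holomorphic_at_neq_0 _ _ (holomorphic_at_id z) Hz).
    apply filter_imp; intros x Hx; symmetry; now apply Psi1_neq_0.
  + apply holomorphic_at_div; [ | apply holomorphic_at_id | easy].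
    apply holomorphic_at_minus; [apply entire_Cexp | apply holomorphic_at_const].
Qed.

(** Combined with [Cexp_Psi], this says that y = [Psi x] solves y' = 1 + x y, the equation behind
    the affine flow. *)
Lemma is_C_derive_Psi (x t : C) : is_C_derive (Psi x) t (Cexp (x * t)).
Proof.
destruct (Ceq_dec x 0) as [-> | Hx].
- apply is_C_derive_ext with (fun t => t).
  { intros s; symmetry; apply Psi_0_l. }
  rewrite Cmult_0_l, Cexp_0; apply is_C_derive_id.
- apply is_C_derive_ext with (fun t => (Cexp (x * t) - 1) * / x).
  { intros s; symmetry; now apply Psi_closed. }
  replace (Cexp (x * t)) with
    (((0 * t + x * 1) * Cexp (x * t) - 0) * / x + (Cexp (x * t) - 1) * 0)
    by (field; easy).
  apply (is_C_derive_mult (fun t => Cexp (x * t) - 1) (fun _ => / x));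
    [ | apply is_C_derive_const].
  apply is_C_derive_minus; [ | apply is_C_derive_const].
  apply is_C_derive_comp; [apply is_C_derive_Cexp | ].
  apply (is_C_derive_mult (fun _ => x) (fun t => t));
    [apply is_C_derive_const | apply is_C_derive_id].
Qed.

(** Along the real segment from [0] to [z], the function [t |-> f (t * z)] has zero real derivative,
    so its values at both ends agree. *)
Lemma is_C_derive_0_const (f : C -> C) :
  (forall z, is_C_derive f z 0) -> forall z, f z = f 0.
Proof.
intros H z.
replace z with (1%R * z) at 1 by ring; replace (RtoC 0) with (0%R * z) by ring.
symmetry.
apply (eq_is_derive (V := C_R_NormedModule) (fun t : R => f (t * z)));
  [ | apply Rlt_0_1].
intros t _; destruct (H (t * z)) as [_ D].
specialize (D (t * z) (fun P HP => HP)).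
split; [apply is_linear_scal_l | ].
intros t' Ht.
apply (is_filter_lim_locally_unique (V := AbsRing_NormedModule R_AbsRing)) in Ht.
subst t'; intros eps.
(* Passing from [t] to [t * z] scales distances by [Cmod z], so both tolerances are divided by a
   bound for it; the added [1] keeps the divisor positive when [z = 0]. *)
assert (Hz : (0 < Cmod z + 1)%R) by (pose proof (Cmod_ge_0 z); lra).
assert (He : (0 < eps / (Cmod z + 1))%R)
  by (apply Rdiv_lt_0_compat; [apply cond_pos | easy]).
destruct (D (mkposreal _ He)) as [d Hd].
assert (Hd' : (0 < d / (Cmod z + 1))%R)
  by (apply Rdiv_lt_0_compat; [apply cond_pos | easy]).
exists (mkposreal _ Hd'); intros y Hy.
change (Rabs (y - t) < d / (Cmod z + 1))%R in Hy.
assert (E : Cmod (y * z - t * z) = (Rabs (y - t) * Cmod z)%R).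
{ rewrite <- Cmod_R, <- Cmod_mult, RtoC_minus; f_equal; ring. }
assert (B : (Cmod (y * z - t * z) < d)%R).
{ rewrite E; apply Rmult_lt_compat_r with (1 := Hz) in Hy.
  replace (d / (Cmod z + 1) * (Cmod z + 1))%R with (pos d) in Hy by (field; lra).
  pose proof (Rabs_pos (y - t)); nra. }
specialize (Hd (y * z) B).
change (Cmod (f (y * z)%C - f (t * z)%C - (y * z - t * z) * 0)
  <= eps / (Cmod z + 1) * Cmod (y * z - t * z))%R in Hd.
rewrite E in Hd.
replace (norm _) with (Cmod (f (y * z) - f (t * z) - (y * z - t * z) * 0)).
- eapply Rle_trans; [exact Hd | ].
  change (eps / (Cmod z + 1) * (Rabs (y - t) * Cmod z) <= eps * Rabs (y - t))%R.
  apply Rle_trans with (eps / (Cmod z + 1) * (Rabs (y - t) * (Cmod z + 1)))%R.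
  + apply Rmult_le_compat_l; [lra | ].
    apply Rmult_le_compat_l; [apply Rabs_pos | lra].
  + right; field; lra.
- rewrite Cmod_norm; f_equal.
  rewrite (scal_zero_r (V := C_R_NormedModule)).
  rewrite (minus_zero_r (G := C_R_NormedModule)).
  change (f (y * z) - f (t * z) - (y * z - t * z) * 0 = f (y * z) - f (t * z)).
  ring.
Qed.

(** * Differentials of maps into and out of [C2] *)

Lemma filterdiff_pair {K : AbsRing} {T U V : NormedModule K}
  (F : (T -> Prop) -> Prop) {FF : Filter F} (f lf : T -> U) (g lg : T -> V) :
  filterdiff f F lf -> filterdiff g F lg ->
  filterdiff (V := prod_NormedModule K U V) (fun t => (f t, g t)) F
    (fun t => (lf t, lg t)).
Proof.
intros Hf Hg.
apply (filterdiff_comp_2 (W := prod_NormedModule K U V) f g pair lf lg pair);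
  [easy | easy | ].
apply filterdiff_linear, is_linear_prod;
  [apply is_linear_fst | apply is_linear_snd].
Qed.

Lemma C2_filterdiff_fst {F : (C2 -> Prop) -> Prop} :
  filterdiff (U := C2) (V := C_NormedModule) fst F fst.
Proof.
apply filterdiff_linear.
apply (is_linear_fst (U := C_NormedModule) (V := C_NormedModule)).
Qed.

Lemma C2_filterdiff_snd {F : (C2 -> Prop) -> Prop} :
  filterdiff (U := C2) (V := C_NormedModule) snd F snd.
Proof.
apply filterdiff_linear.
apply (is_linear_snd (U := C_NormedModule) (V := C_NormedModule)).
Qed.

Lemma is_derive_C2 (u v : C -> C) (t a b : C) :
  is_derive (K := C_AbsRing) (V := C2) (fun s => (u s, v s)) t (a, b)
  <-> is_C_derive u t a /\ is_C_derive v t b.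
Proof.
split.
- intros H; split.
  + exact (filterdiff_comp' (U := C_self) (V := C2) (W := C_NormedModule)
      _ _ t _ _ H C2_filterdiff_fst).
  + exact (filterdiff_comp' (U := C_self) (V := C2) (W := C_NormedModule)
      _ _ t _ _ H C2_filterdiff_snd).
- intros [Hu Hv].
  exact (filterdiff_pair (T := C_self) _ _ _ _ _ Hu Hv).
Qed.

Lemma Cminus_eq_0 (x y : C) : x - y = 0 -> x = y.
Proof. intros H; replace x with (x - y + y) by ring; rewrite H; ring. Qed.

(** * The flow of the vector field: explicit formula and uniqueness *)

Definition flow_line (q q1 g1 : C -> C) (z w t : C) : C :=
  w + (g_fun q1 g1 z * w - q z / Cexp (g1 z)) * Psi (g_fun q1 g1 z) t.

Lemma Z_field_eq (q q1 g1 : C -> C) (z w : C) :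
  Z_field q q1 g1 (z, w)
  = (RtoC 0, g_fun q1 g1 z * w - q z / Cexp (g1 z)).
Proof.
unfold Z_field, g_fun; simpl fst; simpl snd; f_equal.
rewrite Cexp_opp; field; apply Cexp_neq_0.
Qed.

Lemma flow_line_0 (q q1 g1 : C -> C) (z w : C) : flow_line q q1 g1 z w 0 = w.
Proof. unfold flow_line; rewrite Psi_eq; ring. Qed.

Lemma is_C_derive_flow_line (q q1 g1 : C -> C) (z w t : C) :
  is_C_derive (flow_line q q1 g1 z w) t
    (g_fun q1 g1 z * flow_line q q1 g1 z w t - q z / Cexp (g1 z)).
Proof.
unfold flow_line; set (G := g_fun q1 g1 z); set (c := q z / _).
(* Both sides equal [(G * w - c) * Cexp (G * t)], because [Cexp (G * t)] is [1 + G * Psi G t]; the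
   right one has the shape of the sum and product rules. *)
replace (G * (w + (G * w - c) * Psi G t) - c) with
  (0 + (0 * Psi G t + (G * w - c) * Cexp (G * t))) by (rewrite Cexp_Psi; ring).
apply is_C_derive_plus; [apply is_C_derive_const | ].
apply (is_C_derive_mult (fun _ => G * w - c) (Psi G));
  [apply is_C_derive_const | apply is_C_derive_Psi].
Qed.

Lemma integral_curve_flow_line (q q1 g1 : C -> C) (z w : C) :
  integral_curve (Z_field q q1 g1) (z, w) (fun t => (z, flow_line q q1 g1 z w t)).
Proof.
split; [now rewrite flow_line_0 | intros t].
rewrite Z_field_eq; apply is_derive_C2.
split; [apply is_C_derive_const | apply is_C_derive_flow_line].
Qed.

(* The difference [d] of the second components satisfies [d' = g(z) d], so that
   [d e^(-g(z) t)] is constant. *)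
Lemma integral_curve_unique (q q1 g1 : C -> C) (z w : C) (gamma : C -> C2) :
  integral_curve (Z_field q q1 g1) (z, w) gamma ->
  forall t, gamma t = (z, flow_line q q1 g1 z w t).
Proof.
intros [H0 H].
assert (H' : forall t, is_C_derive (fun s => fst (gamma s)) t 0 /\
  is_C_derive (fun s => snd (gamma s)) t
    (g_fun q1 g1 (fst (gamma t)) * snd (gamma t)
     - q (fst (gamma t)) / Cexp (g1 (fst (gamma t))))).
{ intros t; apply is_derive_C2; rewrite <- Z_field_eq.
  rewrite <- surjective_pairing.
  apply (is_derive_ext (V := C2) gamma); [ | apply H].
  intros s; apply surjective_pairing. }
(* The first component has zero derivative, so the curve stays on one vertical line and the equation
   for the second component has constant coefficients. *)
assert (H1 : forall t, fst (gamma t) = z).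
{ intros t.
  rewrite (is_C_derive_0_const (fun s => fst (gamma s)) (fun t => proj1 (H' t)) t).
  now rewrite H0. }
set (G := g_fun q1 g1 z); set (b := flow_line q q1 g1 z w).
set (k := fun t => (snd (gamma t) - b t) * Cexp (- G * t)).
assert (Hk : forall t, k t = 0).
{ intros t; rewrite (is_C_derive_0_const k).
  - unfold k, b; rewrite H0, flow_line_0; simpl; ring.
  - clear t; intros t; unfold k.
    destruct (H' t) as [_ D]; rewrite H1 in D.
    set (c := q z / Cexp (g1 z)) in D.
    (* The inhomogeneous term [c] cancels in the difference of the two solutions, and the factor
       [Cexp (- G * t)] compensates the remaining growth rate [G]. *)
    replace (RtoC 0) with
      (((G * snd (gamma t) - c) - (G * b t - c)) * Cexp (- G * t)
       + (snd (gamma t) - b t) * ((0 * t + - G * 1) * Cexp (- G * t))) by ring.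
    apply (is_C_derive_mult (fun t => snd (gamma t) - b t)
      (fun t => Cexp (- G * t))).
    + apply is_C_derive_minus; [exact D | apply is_C_derive_flow_line].
    + apply is_C_derive_comp; [apply is_C_derive_Cexp | ].
      apply (is_C_derive_mult (fun _ => - G) (fun t => t));
        [apply is_C_derive_const | apply is_C_derive_id]. }
intros t; rewrite (surjective_pairing (gamma t)), H1; f_equal; fold b.
apply Cminus_eq_0.
destruct (Ceq_dec (snd (gamma t) - b t) 0) as [E | E]; [exact E | ].
destruct (Cmult_neq_0 _ _ E (Cexp_neq_0 (- G * t)) (Hk t)).
Qed.

(** * Principal parts and the entire function [h] *)

Lemma quot_P1_Fin (a b c : C) : quot_P1 a b = Fin c -> b <> 0 /\ c = a / b.
Proof.
unfold quot_P1; destruct (Ceq_dec b 0); intros H; [easy | ].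
split; [easy | congruence].
Qed.

(** Subtracting the two local expansions cancels the common principal part, so s - 1/g, which is (q
    - e^g1) / q1, continues holomorphically across [p]. As [s] is finite on a punctured
    neighbourhood, [q1] has no zero there. *)
Lemma principal_parts_difference (s : C -> P1) (q q1 g1 : C -> C)
  (s_quot : forall z : C, s z = quot_P1 (q z) (q1 z))
  (same_pp : same_principal_parts (fun z => inv_P1 (Fin (g_fun q1 g1 z))) s)
  (p : C) :
  exists u : C -> C,
    locally (T := C_UniformSpace) p (holomorphic_at u) /\
    locally' (T := C_UniformSpace) p
      (fun z => q1 z <> 0 /\ (q z - Cexp (g1 z)) / q1 z = u z).
Proof.
destruct (same_pp p) as [a [N [[u1 [Hu1 E1]] [u2 [Hu2 E2]]]]].
exists (fun z => u2 z - u1 z); split.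
- generalize (filter_and _ _ Hu1 Hu2); apply filter_imp.
  intros z [h1 h2]; now apply holomorphic_at_minus.
- generalize (filter_and _ _ E1 E2); apply filter_imp.
  intros z [e1 e2]; rewrite s_quot in e2; unfold inv_P1 in e1.
  apply quot_P1_Fin in e1; apply quot_P1_Fin in e2.
  destruct e1 as [_ e1], e2 as [H e2]; split; [easy | ].
  transitivity (q z / q1 z - 1 / g_fun q1 g1 z).
  + unfold g_fun; field; split; [apply Cexp_neq_0 | easy].
  + rewrite <- e1, <- e2; ring.
Qed.

(** A point near [p] but different from it has a neighbourhood that avoids [p], on which [P] holds
    outright; at [p] itself the hypothesis applies. *)
Lemma locally'_locally (p : C) (P : C -> Prop) :
  locally' (T := C_UniformSpace) p P ->
  locally (T := C_UniformSpace) p (fun z => locally' (T := C_UniformSpace) z P).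
Proof.
intros H; generalize (locally_locally _ _ H); apply filter_imp; intros z Hz.
destruct (Ceq_dec z p) as [-> | Hzp]; [exact H | ].
assert (N : locally (T := C_UniformSpace) z (fun y => y <> p)).
{ generalize (holomorphic_at_neq_0 (fun y => y - p) z
    (holomorphic_at_minus _ _ _ (holomorphic_at_id z) (holomorphic_at_const p z))).
  intros K; generalize (K ltac:(intros E; apply Hzp; now apply Cminus_eq_0)).
  apply filter_imp; intros y Hy E; apply Hy; rewrite E; ring. }
unfold locally', within; generalize (filter_and _ _ Hz N); apply filter_imp.
intros y [A B] _; exact (A B).
Qed.

Lemma holomorphic_at_filterlim' (f : C -> C) (z : C) : holomorphic_at f z ->
  filterlim f (locally' (T := C_UniformSpace) z)
    (locally (T := C_UniformSpace) (f z)).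
Proof.
intros H; apply filterlim_filter_le_1 with (2 := holomorphic_at_continuous _ _ H).
intros P HP; unfold locally', within; revert HP; apply filter_imp; easy.
Qed.

(** Local continuations come from existential statements and vary with the point. [C_lim] defines
    one global function that agrees with each of them, singular points included. *)
Lemma C_lim_continuation (f u : C -> C) (p : C) :
  locally (T := C_UniformSpace) p (holomorphic_at u) ->
  locally' (T := C_UniformSpace) p (fun z => f z = u z) ->
  locally (T := C_UniformSpace) p (fun z => C_lim f z = u z).
Proof.
intros Hu Hf; generalize (filter_and _ _ Hu (locally'_locally _ _ Hf)).
apply filter_imp; intros z [hu hf]; apply is_C_lim_unique.
apply filterlim_ext_loc with u.
- revert hf; apply filter_imp; congruence.
- now apply holomorphic_at_filterlim'.
Qed.

(** Near each point the limit function coincides with a holomorphic continuation, hence it is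
    entire. Where [s] is finite, [q1] does not vanish and the limit is the value of the quotient,
    that is s - 1/g. *)
Lemma exists_entire_difference (s : C -> P1) (q q1 g1 : C -> C)
  (q_entire : entire q) (q1_entire : entire q1) (g1_entire : entire g1)
  (s_quot : forall z : C, s z = quot_P1 (q z) (q1 z))
  (same_pp : same_principal_parts (fun z => inv_P1 (Fin (g_fun q1 g1 z))) s) :
  is_entire_difference s (g_fun q1 g1)
    (C_lim (fun z => (q z - Cexp (g1 z)) / q1 z)).
Proof.
split.
- intros p.
  destruct (principal_parts_difference s q q1 g1 s_quot same_pp p) as [u [Hu E]].
  apply holomorphic_at_ext_loc with u; [ | exact (locally_singleton _ _ Hu)].
  apply filter_imp
    with (fun z => C_lim (fun z => (q z - Cexp (g1 z)) / q1 z) z = u z); [easy | ].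
  apply C_lim_continuation; [easy | ].
  revert E; apply filter_imp; easy.
- intros z a Ha; rewrite s_quot in Ha; apply quot_P1_Fin in Ha as [Hz ->].
  transitivity ((q z - Cexp (g1 z)) / q1 z).
  + apply is_C_lim_unique.
    apply (holomorphic_at_filterlim' (fun z => (q z - Cexp (g1 z)) / q1 z)).
    apply holomorphic_at_div; [ | apply q1_entire | easy].
    apply holomorphic_at_minus; [apply q_entire | ].
    apply holomorphic_at_comp; [apply entire_Cexp | apply g1_entire].
  + unfold g_fun; field; split; [apply Cexp_neq_0 | easy].
Qed.

(* The principal parts show that the zeros of [q1] are isolated, so the identity
   extends to them by continuity. *)
Lemma entire_difference_eq (s : C -> P1) (q q1 g1 h : C -> C)
  (q_entire : entire q) (q1_entire : entire q1) (g1_entire : entire g1)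
  (s_quot : forall z : C, s z = quot_P1 (q z) (q1 z))
  (same_pp : same_principal_parts (fun z => inv_P1 (Fin (g_fun q1 g1 z))) s)
  (Hh : is_entire_difference s (g_fun q1 g1) h) (p : C) :
  q1 p * h p = q p - Cexp (g1 p).
Proof.
destruct Hh as [h_entire Hh].
destruct (principal_parts_difference s q q1 g1 s_quot same_pp p) as [u [_ E]].
assert (L1 := holomorphic_at_filterlim' _ _
  (holomorphic_at_mult _ _ _ (q1_entire p) (h_entire p))).
assert (L2 := holomorphic_at_filterlim' _ _
  (holomorphic_at_minus _ _ _ (q_entire p)
     (holomorphic_at_comp _ _ _ (entire_Cexp _) (g1_entire p)))).
(* Each side at [p] is its own limit through points other than [p], where [q1] is nonzero and the
   identity is algebra. *)
rewrite <- (is_C_lim_unique _ _ _ L1); apply is_C_lim_unique.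
revert L2; apply filterlim_ext_loc.
revert E; apply filter_imp; intros z [H _].
rewrite (Hh z (q z / q1 z)).
- unfold g_fun; field; split; [apply Cexp_neq_0 | easy].
- rewrite s_quot; unfold quot_P1; now destruct (Ceq_dec (q1 z) 0).
Qed.

(** * The map [Phi]: link with the flow, differential, and domination *)

Lemma Phi_flow_line (s : C -> P1) (q q1 g1 h : C -> C)
  (q_entire : entire q) (q1_entire : entire q1) (g1_entire : entire g1)
  (s_quot : forall z : C, s z = quot_P1 (q z) (q1 z))
  (same_pp : same_principal_parts (fun z => inv_P1 (Fin (g_fun q1 g1 z))) s)
  (Hh : is_entire_difference s (g_fun q1 g1) h) (z t : C) :
  Phi (g_fun q1 g1) h (z, t) = (z, flow_line q q1 g1 z (h z) t).
Proof.
unfold Phi, flow_line; simpl; f_equal.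
replace (g_fun q1 g1 z * h z - q z / Cexp (g1 z)) with (Copp 1).
- ring.
- assert (E := entire_difference_eq s q q1 g1 h q_entire q1_entire g1_entire
    s_quot same_pp Hh z).
  replace (g_fun q1 g1 z * h z) with (q1 z * h z / Cexp (g1 z))
    by (unfold g_fun; field; apply Cexp_neq_0).
  rewrite E; field; apply Cexp_neq_0.
Qed.

(** Writing [Psi (g z) t] as [t * Psi1 (g z * t)] reduces the total differential to chain and
    product rules with one-variable derivatives. *)
Lemma filterdiff_Phi (g h : C -> C) (p : C2) (a b c : C) :
  is_C_derive g (fst p) a -> is_C_derive h (fst p) b ->
  is_C_derive Psi1 (g (fst p) * snd p) c ->
  filterdiff (U := C2) (V := C2) (Phi g h) (locally p) (fun v : C2 =>
    (fst v, fst v * b - (snd v * Psi1 (g (fst p) * snd p)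
       + snd p * ((fst v * a * snd p + g (fst p) * snd v) * c)))).
Proof.
intros Hg Hh Hc.
apply filterdiff_C_self in Hg, Hh, Hc.
assert (D1 := proj2 (filterdiff_C_self C2 _ (locally p) _) C2_filterdiff_fst).
assert (D2 := proj2 (filterdiff_C_self C2 _ (locally p) _) C2_filterdiff_snd).
apply (filterdiff_ext (U := C2) (V := C2)
  (fun v : C2 => (fst v, h (fst v) - snd v * Psi1 (g (fst v) * snd v)))).
{ intros v; unfold Phi; now rewrite Psi_eq. }
apply (filterdiff_pair (T := C2) (U := C_NormedModule) (V := C_NormedModule)
  (locally p) (fun v => fst v) (fun v => fst v)).
{ exact C2_filterdiff_fst. }
(* The product rule [filterdiff_mult_fct] takes values in the ring as a module over itself, hence
   the passage to [C_self]. *)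
apply filterdiff_C_self.
assert (comp : forall (f : C2 -> C) (k : C -> C) lf lk,
  filterdiff (U := C2) (V := C_self) f (locally p) lf ->
  filterdiff (U := C_self) (V := C_self) k
    (locally (T := C_self) (f p)) lk ->
  filterdiff (U := C2) (V := C_self) (fun v => k (f v)) (locally p)
    (fun v => lk (lf v))).
{ intros f k lf lk.
  exact (filterdiff_comp' (U := C2) (V := C_self) (W := C_self) f k p lf lk). }
assert (Dg := comp _ g _ _ D1 Hg).
assert (Dh := comp _ h _ _ D1 Hh).
assert (Dgt := filterdiff_mult_fct (U := C2) _ _ p _ _ Cmult_comm Dg D2).
assert (DP := comp _ Psi1 _ _ Dgt Hc).
assert (DtP := filterdiff_mult_fct (U := C2) _ _ p _ _ Cmult_comm D2 DP).
exact (filterdiff_minus_fct (U := C2) (V := C_self) _ _ _ _ Dh DtP).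
Qed.

Lemma g_fun_entire (q1 g1 : C -> C) :
  entire q1 -> entire g1 -> entire (g_fun q1 g1).
Proof.
intros H1 H2 z; apply (holomorphic_at_div q1 (fun z => Cexp (g1 z)));
  [apply H1 | | apply Cexp_neq_0].
apply holomorphic_at_comp; [apply entire_Cexp | apply H2].
Qed.

(** Where [s] is finite, [q1] and hence [g] do not vanish; then the term -1/g of [h] cancels the
    constant term of the closed form of [Psi]. *)
Lemma Phi_eq_at_finite (s : C -> P1) (q q1 g1 h : C -> C)
  (s_quot : forall z : C, s z = quot_P1 (q z) (q1 z))
  (Hh : is_entire_difference s (g_fun q1 g1) h) (z t a : C) :
  s z = Fin a ->
  g_fun q1 g1 z <> 0 /\
  Phi (g_fun q1 g1) h (z, t)
  = (z, a - Cexp (g_fun q1 g1 z * t) / g_fun q1 g1 z).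
Proof.
intros Hs; assert (H := Hs); rewrite s_quot in H; apply quot_P1_Fin in H as [H _].
assert (Hg : g_fun q1 g1 z <> 0).
{ intros E; apply H; replace (q1 z) with (g_fun q1 g1 z * Cexp (g1 z)).
  - rewrite E; ring.
  - unfold g_fun; field; apply Cexp_neq_0. }
split; [easy | unfold Phi; simpl; f_equal].
rewrite (proj2 Hh z a Hs), Psi_closed by easy; field; easy.
Qed.

Lemma Phi_dominating (s : C -> P1) (q q1 g1 h : C -> C)
  (q1_entire : entire q1) (g1_entire : entire g1)
  (s_quot : forall z : C, s z = quot_P1 (q z) (q1 z))
  (Hh : is_entire_difference s (g_fun q1 g1) h) :
  dominating_map (Phi (g_fun q1 g1) h) (fun p => ~ graph s p).
Proof.
assert (D : forall p : C2, exists a b c : C,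
  filterdiff (U := C2) (V := C2) (Phi (g_fun q1 g1) h) (locally p) (fun v : C2 =>
    (fst v, fst v * b - (snd v * Psi1 (g_fun q1 g1 (fst p) * snd p)
       + snd p * ((fst v * a * snd p + g_fun q1 g1 (fst p) * snd v) * c))))).
{ intros p.
  destruct (g_fun_entire q1 g1 q1_entire g1_entire (fst p)) as [a Ha].
  destruct (proj1 Hh (fst p)) as [b Hb].
  destruct (entire_Psi1 (g_fun q1 g1 (fst p) * snd p)) as [c Hc].
  exists a, b, c; now apply filterdiff_Phi. }
split; [ | split].
(* A point of the graph lies over a finite value of [s], and there the second component of [Phi]
   differs from [s] by e^(gt)/g, which is never zero. *)
- intros [z t] Hgr; unfold graph in Hgr; simpl in Hgr.
  destruct (Phi_eq_at_finite s q q1 g1 h s_quot Hh z t _ Hgr) as [Hg E].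
  apply (f_equal snd) in E; simpl in E.
  set (w := h z - _) in E; set (e := Cexp _) in E.
  apply (Cexp_neq_0 (g_fun q1 g1 z * t)); fold e.
  replace e with ((w - (w - e / g_fun q1 g1 z)) * g_fun q1 g1 z) by (field; easy).
  rewrite <- E; ring.
- intros p; destruct (D p) as [a [b [c H]]]; eexists; exact H.
(* At [t = 0] the Jacobian matrix is triangular with diagonal entries [1] and [- Psi1 0], so its
   determinant is -1. *)
- destruct (D (RtoC 0, RtoC 0)) as [a [b [c H]]].
  eexists _, _; split; [exact H | ].
  unfold jacobian_det; simpl fst; simpl snd.
  rewrite Cmult_0_r, Psi1_0.
  intros E; apply C1_nz; transitivity (Copp 0); [rewrite <- E | ]; ring.
Qed.

Theorem corollary1 (s : C -> P1) (q q1 g1 : C -> C)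
  (s_mero : meromorphic s)
  (s_not_Inf : exists z : C, s z <> Inf)
  (q_entire : entire q)
  (q1_entire : entire q1)
  (no_common_zero : forall z : C, ~ (q z = 0 /\ q1 z = 0))
  (s_quot : forall z : C, s z = quot_P1 (q z) (q1 z))
  (g1_entire : entire g1)
  (same_pp : same_principal_parts
               (fun z => inv_P1 (Fin (g_fun q1 g1 z))) s) :
  complete_vector_field (Z_field q q1 g1) /\
  (exists h : C -> C, is_entire_difference s (g_fun q1 g1) h) /\
  (forall x y : C, x <> 0 -> Psi x y = (Cexp (x * y) - 1) / x) /\
  (forall h : C -> C, is_entire_difference s (g_fun q1 g1) h ->
     dominating_map (Phi (g_fun q1 g1) h) (fun p => ~ graph s p) /\
     (forall z t a : C, s z = Fin a ->
        Phi (g_fun q1 g1) h (z, t)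
        = (z, a - Cexp (g_fun q1 g1 z * t) / g_fun q1 g1 z)) /\
     (forall phi : C -> C2 -> C2, is_complex_flow (Z_field q q1 g1) phi ->
        forall z t : C, phi t (z, h z) = Phi (g_fun q1 g1) h (z, t))).
Proof.
split; [ | split; [ | split]].
- intros [z w]; exists (fun t => (z, flow_line q q1 g1 z w t)).
  apply integral_curve_flow_line.
- eexists; now apply exists_entire_difference.
- exact Psi_closed.
- intros h Hh; split; [ | split].
  + now apply Phi_dominating with q.
  + intros z t a Ha; now apply Phi_eq_at_finite with (s := s) (q := q).
  + intros phi Hphi z t; rewrite (Phi_flow_line s q q1 g1 h) by easy.
    now apply (integral_curve_unique q q1 g1 z (h z) (fun t => phi t (z, h z))).
Qed.
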